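(* Let $n\geq 2$ be an integer that is odd or equal to $2$ or $4$. Then, as $\mathcal{S}_n$-lattices, $$\bigwedge^2 A_{n-1}\sim A_{n-1}^{\otimes 2}.$$
   Context: $\mathcal{S}_n$ is the symmetric group on $\{1,\ldots,n\}$. The $\mathcal{S}_n$-lattice $A_{n-1}$ is $\{(z_1,\ldots,z_n)\in\mathbb{Z}^n\mid\sum_i z_i=0\}$ with $\mathcal{S}_n$ permuting the coordinates of $\mathbb{Z}^n$. Tensor products are over $\mathbb{Z}$; $A_{n-1}^{\otimes 2}=A_{n-1}\otimes A_{n-1}$ with diagonal action, and $\bigwedge^2A_{n-1}$ is the quotient of $A_{n-1}^{\otimes 2}$ by the subgroup generated by all $m\otimes m$, $m\in A_{n-1}$, with the induced action. For a finite group $\mathcal{G}$, a $\mathcal{G}$-lattice is a $\mathbb{Z}[\mathcal{G}]$-module that is free of finite rank over $\mathbb{Z}$; a permutation $\mathcal{G}$-lattice is one having a $\mathbb{Z}$-basis permuted by $\mathcal{G}$. Two $\mathcal{G}$-lattices $M,N$ are equivalent, $M\sim N$, if there are exact sequences of $\mathcal{G}$-lattices $0\to M\to E\to P\to 0$ and $0\to N\to E\to Q\to 0$ (same $E$) with $P,Q$ permutation $\mathcal{G}$-lattices. *)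

(* Defs.v *)
From HB Require Import structures.
From mathcomp Require Import all_boot all_order all_algebra all_fingroup.
From mathcomp Require Import boolp freeg.

Set Implicit Arguments.
Unset Strict Implicit.
Unset Printing Implicit Defensive.

Import GRing.Theory.

Local Open Scope ring_scope.
Local Open Scope quotient_scope.

(* Z[G]-modules are abelian groups with an additive right action of G. Since   *)
(* MathComp composes permutations from left to right, a right action of its    *)
(* group 'S_n is exactly a left action of the symmetric group with the usual   *)
(* composition; for a general G the two conventions differ by g |-> g^-1.      *)
Record gmodule (gT : finGroupType) := GModule {
  gmod_sort :> zmodType;
  gmod_act : {action gT &-> gmod_sort};
  gmod_actB : forall a, zmod_morphism (gmod_act^~ a) }.

Arguments gmod_act {gT} M : rename.
Arguments gmod_actB {gT} M : rename.

(* The library states these for actions on finite types only. *)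
Section InfiniteActions.
Variables (aT : finGroupType) (T : Type) (to : {action aT &-> T}).

Lemma tactM x a b : to x (a * b)%g = to (to x a) b.
Proof. by case: to => f [_ fM] /=; rewrite fM ?inE. Qed.

Lemma tact1 x : to x 1%g = x.
Proof.
have: to (to x 1%g) 1%g = to x 1%g by rewrite -tactM mulg1.
by case: to => f [f_inj _] /=; apply: f_inj.
Qed.

End InfiniteActions.

Lemma gmod_actD (gT : finGroupType) (L : gmodule gT) (x y : L) a :
  gmod_act L (x + y) a = gmod_act L x a + gmod_act L y a.
Proof.
have g0 : gmod_act L 0 a = 0 by have := gmod_actB L a 0 0; rewrite !subrr.
have gN z : gmod_act L (- z) a = - gmod_act L z a.
  by rewrite -[- z]sub0r gmod_actB g0 sub0r.
by rewrite -[y in LHS]opprK gmod_actB gN opprK.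
Qed.

Section GLattices.
Variable gT : finGroupType.
Implicit Types M N E P Q : gmodule gT.

Definition is_zbasis (V : zmodType) r (b : 'I_r -> V) : Prop :=
  forall x : V, exists! c : {ffun 'I_r -> int}, x = \sum_i b i *~ c i.

Definition is_lattice M : Prop := exists r (b : 'I_r -> M), is_zbasis b.

Definition is_permutation_lattice M : Prop :=
  exists r (b : 'I_r -> M),
    is_zbasis b /\ forall i a, exists j, gmod_act M (b i) a = b j.

Definition equivariant M N (f : M -> N) : Prop :=
  forall x a, f (gmod_act M x a) = gmod_act N (f x) a.

(* There are G-maps making 0 -> M -> E -> P -> 0 exact. *)
Definition short_exact M E P : Prop :=
  exists (f : {additive M -> E}) (h : {additive E -> P}),
    [/\ equivariant f, equivariant h, injective f,
        forall y, h y = 0 <-> exists x, y = f x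
      & forall z, exists y, h y = z].

Definition lattice_equiv M N : Prop :=
  [/\ is_lattice M, is_lattice N &
    exists E P Q : gmodule gT,
      [/\ is_lattice E, is_permutation_lattice P, is_permutation_lattice Q,
          short_exact M E P & short_exact N E Q]].

End GLattices.

Section GeneratedSubgroup.
Variables (V : zmodType) (S : V -> Prop).

Inductive generated : V -> Prop :=
| generated_in x : S x -> generated x
| generated0 : generated 0
| generatedB x y : generated x -> generated y -> generated (x - y).

Definition gen_subgroup : {pred V} := fun x => `[< generated x >].

Lemma gen_subgroupP x : reflect (generated x) (x \in gen_subgroup).
Proof. exact: asboolP. Qed.

Lemma gen_subgroup_closed : zmod_closed gen_subgroup.
Proof.
split=> [|x y /gen_subgroupP gx /gen_subgroupP gy]; apply/gen_subgroupP.
  exact: generated0.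
exact: generatedB.
Qed.

HB.instance Definition _ :=
  GRing.isZmodClosed.Build V gen_subgroup gen_subgroup_closed.

End GeneratedSubgroup.

Section QuotientModule.
Variables (gT : finGroupType) (M : gmodule gT) (S : M -> Prop).
Hypothesis stableS : forall x a, S x -> S (gmod_act M x a).

Local Notation Qt := (Quotient.quot (gen_subgroup S)).

Lemma generated_stable x a : generated S x -> generated S (gmod_act M x a).
Proof.
elim=> {x}[x Sx||x y _ IHx _ IHy].
- exact/generated_in/stableS.
- have := gmod_actB M a 0 0; rewrite !subrr => ->; exact: generated0.
- by rewrite gmod_actB; apply: generatedB.
Qed.

Definition quot_act (x : Qt) (a : gT) : Qt :=
  \pi_Qt (gmod_act M (generic_quotient.repr x) a).

Lemma quot_act_pi (x : M) a : quot_act (\pi_Qt x) a = \pi_Qt (gmod_act M x a).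
Proof.
apply/eqP; rewrite /quot_act -Quotient.idealrBE -gmod_actB.
apply/gen_subgroupP/generated_stable/gen_subgroupP.
by rewrite Quotient.idealrBE reprK.
Qed.

Lemma quot_act_is_action : is_action [set: gT]%g quot_act.
Proof.
apply: is_total_action => [x|x a b]; rewrite -[x]reprK !quot_act_pi.
  by rewrite tact1.
by rewrite tactM reprK.
Qed.

Lemma quot_actB a : zmod_morphism (quot_act^~ a).
Proof.
move=> x y; rewrite -[x]reprK -[y]reprK.
by rewrite -raddfB !quot_act_pi -raddfB gmod_actB.
Qed.

(* M modulo the subgroup generated by the G-stable subset S *)
Definition quotient_gmodule : gmodule gT :=
  @GModule gT Qt (Action quot_act_is_action) quot_actB.

End QuotientModule.

Section FreeModule.
Variables (gT : finGroupType) (K : choiceType) (to : {action gT &-> K}).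

Local Notation F := {freeg K / int}.

Definition free_act (x : F) (a : gT) : F :=
  fglift (fun k => << to k a >> : F) x.

Lemma free_actU k a : free_act << k >> a = << to k a >>.
Proof. by rewrite /free_act liftU scale1r. Qed.

Lemma free_actB a : zmod_morphism (free_act^~ a).
Proof. exact: lift_is_additive. Qed.

Lemma freeg_ext (V : zmodType) (f g : F -> V) :
  zmod_morphism f -> zmod_morphism g ->
  (forall k, f << k >> = g << k >>) -> f =1 g.
Proof.
move=> fB gB eq_fg x.
pose f' : {additive F -> V} := HB.pack f (GRing.isZmodMorphism.Build F V f fB).
pose g' : {additive F -> V} := HB.pack g (GRing.isZmodMorphism.Build F V g gB).
have eq_fg' k : f' << k >> = g' << k >> := eq_fg k.
suff: f' x = g' x by [].
rewrite -(freeg_sumE x) 2!raddf_sum; apply: eq_bigr => k _.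
rewrite -[coeff k x]intz -freegU_mulz.
by rewrite 2!raddfMz eq_fg'.
Qed.

Lemma free_act_is_action : is_action [set: gT]%g free_act.
Proof.
apply: is_total_action => [|x a b].
  apply: freeg_ext => [||k]; [exact: free_actB|by []|].
  by rewrite free_actU tact1.
move: x; apply: freeg_ext => [|x y|k].
- exact: free_actB.
- by rewrite !free_actB.
by rewrite !free_actU tactM.
Qed.

(* the free abelian group on the G-set K *)
Definition free_gmodule : gmodule gT :=
  @GModule gT F (Action free_act_is_action) free_actB.

Definition free_gen (k : K) : free_gmodule := << k >>.

Lemma free_gen_act k a : gmod_act free_gmodule (free_gen k) a = free_gen (to k a).
Proof. exact: free_actU. Qed.

End FreeModule.

Section Tensor.
Variables (gT : finGroupType) (M N : gmodule gT).

Definition diag_act (p : M * N) (a : gT) : M * N :=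
  (gmod_act M p.1 a, gmod_act N p.2 a).

Lemma diag_act_is_action : is_action [set: gT]%g diag_act.
Proof.
apply: is_total_action => [[m n]|[m n] a b]; rewrite /diag_act /=.
  by rewrite !tact1.
by rewrite !tactM.
Qed.

Definition free_prod := free_gmodule (Action diag_act_is_action).
Definition free_pair (m : M) (n : N) : free_prod := free_gen _ (m, n).

Inductive tensor_rel : free_prod -> Prop :=
| tensor_rell m1 m2 n :
    tensor_rel (free_pair (m1 + m2) n - free_pair m1 n - free_pair m2 n)
| tensor_relr m n1 n2 :
    tensor_rel (free_pair m (n1 + n2) - free_pair m n1 - free_pair m n2).

Lemma tensor_rel_stable x a : tensor_rel x -> tensor_rel (gmod_act free_prod x a).
Proof.
have actE m n : gmod_act free_prod (free_pair m n) a =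
    free_pair (gmod_act M m a) (gmod_act N n a).
  exact: free_gen_act.
case=> [m1 m2 n|m n1 n2]; rewrite 2!gmod_actB !actE gmod_actD.
  exact: tensor_rell.
exact: tensor_relr.
Qed.

(* M (x) N over Z, with the diagonal action of G *)
Definition tensor : gmodule gT := quotient_gmodule tensor_rel_stable.

Definition tens (m : M) (n : N) : tensor :=
  \pi_(Quotient.quot (gen_subgroup tensor_rel)) (free_pair m n).

Lemma tens_act m n a :
  gmod_act tensor (tens m n) a = tens (gmod_act M m a) (gmod_act N n a).
Proof.
rewrite [LHS](quot_act_pi tensor_rel_stable); congr (\pi _).
exact: free_gen_act.
Qed.

End Tensor.

Section ExteriorSquare.
Variables (gT : finGroupType) (M : gmodule gT).

Definition tensor_square (x : tensor M M) : Prop := exists m : M, x = tens m m.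

Lemma tensor_square_stable x a :
  tensor_square x -> tensor_square (gmod_act (tensor M M) x a).
Proof. by case=> m ->; exists (gmod_act M m a); rewrite tens_act. Qed.

Definition exterior_square : gmodule gT :=
  quotient_gmodule tensor_square_stable.

End ExteriorSquare.

Section LatticeA.
Variable n : nat.

Definition zero_sum : {pred 'rV[int]_n} :=
  [pred z : 'rV[int]_n | \sum_i z 0 i == 0].

Lemma zero_sum_closed : zmod_closed zero_sum.
Proof.
split=> [|x y]; rewrite !inE.
  by rewrite big1 // => i _; rewrite mxE.
move=> /eqP x0 /eqP y0; under eq_bigr do rewrite !mxE.
by rewrite sumrB x0 y0 subrr.
Qed.

HB.instance Definition _ :=
  GRing.isZmodClosed.Build 'rV[int]_n zero_sum zero_sum_closed.

Record zero_sum_vector := ZeroSumVector {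
  zsv_val :> 'rV[int]_n;
  zsv_valP : zsv_val \in zero_sum }.

HB.instance Definition _ := [isSub for zsv_val].
HB.instance Definition _ := [Choice of zero_sum_vector by <:].
HB.instance Definition _ := [SubChoice_isSubZmodule of zero_sum_vector by <:].

Lemma col_perm_zero_sum (s : 'S_n) z :
  z \in zero_sum -> col_perm s z \in zero_sum.
Proof.
rewrite !inE => /eqP z0; apply/eqP.
rewrite -[RHS]z0 [RHS](reindex_inj (@perm_inj _ s)).
by apply: eq_bigr => i _; rewrite mxE.
Qed.

(* s moves the coordinate in position i to position s i. *)
Definition zsv_act (z : zero_sum_vector) (s : 'S_n) : zero_sum_vector :=
  ZeroSumVector (col_perm_zero_sum s^-1%g (zsv_valP z)).

Lemma zsv_actE z s i : zsv_act z s 0 (s i) = z 0 i.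
Proof. by rewrite mxE permK. Qed.

Lemma zsv_act_is_action : is_action [set: 'S_n]%g zsv_act.
Proof.
apply: is_total_action => [z|z s t]; apply/val_inj/rowP => i; rewrite !mxE.
  by rewrite invg1 perm1.
by rewrite invMg permM.
Qed.

Lemma zsv_actB s : zmod_morphism (zsv_act^~ s).
Proof. by move=> x y; apply/val_inj/rowP => i; rewrite !mxE. Qed.

(* the S_n-lattice usually denoted A_{n-1} *)
Definition latticeA : gmodule 'S_n :=
  @GModule _ zero_sum_vector (Action zsv_act_is_action) zsv_actB.

End LatticeA.

(* Main.v *)
Require Import Defs.
From mathcomp Require Import freeg.
From mathcomp Require Import all_boot.
From HB Require Import structures.
From mathcomp Require Import all_order all_algebra all_fingroup.
From mathcomp Require Import boolp zify ring.

(** The antisymmetrization z /\ w |-> z (x) w - w (x) z embeds the exterior square of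
    A = A_{n-1} into its tensor square, with the symmetric square Sym^2 A as quotient.
    If P and Q are permutation lattices with Sym^2 A (+) P isomorphic to Q, then
    E = (A (x) A) (+) P contains A (x) A with quotient P and the exterior square with
    quotient Q, which is the required equivalence ([squares_equiv]). So it is enough
    that Sym^2 A be stably a permutation lattice.

    An element of Sym^2 A is regarded as an integral quadratic form on Z^n with
    (1, ..., 1) in its radical, and it is studied through its values [quad] at indicator
    vectors of subsets. For n = 2 it is determined by one value
    ([squares_equiv_A1]). For n = 4 the values at the four points and at the three
    partitions into pairs are subject to one relation, which splits because
    4 - 3 = 1 ([squares_equiv_A3]). For n odd the values at the subsets of size 1 and
    2 identify Sym^2 A with the kernel of a map from Sym^2 Z^n onto the sublattice
    of Z^n of vectors of even sum; that surjection splits, and the sublattice is stably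
    isomorphic to Z^n ([squares_equiv_odd]). *)

Set Implicit Arguments.
Unset Strict Implicit.
Unset Printing Implicit Defensive.

(** * Quotients and tensor products *)

Section AdditiveMaps.
Import GRing.Theory.
Local Open Scope ring_scope.
Local Open Scope quotient_scope.

Definition additive_of (U V : zmodType) (f : U -> V) (fB : zmod_morphism f) :
    {additive U -> V} :=
  HB.pack f (GRing.isZmodMorphism.Build U V f fB).

(** The target is viewed as a module over the integers, so that the linear extension
    of f makes sense. *)
Lemma free_lift (K : choiceType) (V : zmodType) (f : K -> V) :
  exists F : {additive {freeg K / int} -> V}, forall k, F << k >> = f k.
Proof.
pose F := fglift (f : K -> zmodule V).
have FB : zmod_morphism F := lift_is_additive (f : K -> zmodule V).
exists (additive_of (FB : zmod_morphism (F : _ -> V))) => k.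
by rewrite /= /F liftU scale1r.
Qed.

(** Additivity in the sense of the hierarchy is compatibility with differences;
    bilinearity comes as compatibility with sums. *)
Lemma zmod_morphismD (U V : zmodType) (f : U -> V) :
  {morph f : x y / x + y} -> zmod_morphism f.
Proof.
move=> fD x y; have fN : f (- y) = - f y.
  have f0 : f 0 = 0 by apply: (addrI (f 0)); rewrite -fD !addr0.
  by apply: (addrI (f y)); rewrite -fD !subrr.
by rewrite fD fN.
Qed.

Lemma sum_zmod_morphism (I : finType) (U V : zmodType) (F : I -> {additive U -> V}) :
  zmod_morphism (fun x => \sum_i F i x).
Proof. by move=> x y; rewrite -sumrB; apply: eq_bigr => i _; rewrite raddfB. Qed.

Variable gT : finGroupType.

Lemma gmod_act0 (M : gmodule gT) a : gmod_act M 0 a = 0.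
Proof. by have := gmod_actB M a 0 0; rewrite !subrr. Qed.

Section Quotient.
Variables (M : gmodule gT) (S : M -> Prop).
Hypothesis stableS : forall x a, S x -> S (gmod_act M x a).
Local Notation QM := (quotient_gmodule stableS).

Definition quot_proj (x : M) : QM := \pi_(Quotient.quot (gen_subgroup S)) x.

Lemma quot_projB : zmod_morphism quot_proj.
Proof. exact: raddfB. Qed.

HB.instance Definition _ := GRing.isZmodMorphism.Build M QM quot_proj quot_projB.

Lemma quot_proj_surj y : exists x, y = quot_proj x.
Proof. by exists (generic_quotient.repr y); rewrite /quot_proj reprK. Qed.

Lemma quot_proj0 x : S x -> quot_proj x = 0.
Proof.
move=> Sx; rewrite -[RHS](raddf0 quot_proj); apply/eqP.
by rewrite /quot_proj -Quotient.idealrBE subr0; apply/gen_subgroupP/generated_in.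
Qed.

Lemma quot_proj_act x a : quot_proj (gmod_act M x a) = gmod_act QM (quot_proj x) a.
Proof. by rewrite [RHS](quot_act_pi stableS). Qed.

Lemma quot_lift (V : zmodType) (f : {additive M -> V}) :
  (forall x, S x -> f x = 0) ->
  exists F : {additive QM -> V}, forall x, F (quot_proj x) = f x.
Proof.
move=> f0.
have g0 x : Defs.generated S x -> f x = 0.
  elim=> {x}[x /f0 //||x y _ fx _ fy]; first exact: raddf0.
  by rewrite raddfB fx fy subrr.
pose F (y : QM) := f (generic_quotient.repr y).
have Fpi x : F (quot_proj x) = f x.
  apply/eqP; rewrite -subr_eq0 -raddfB; apply/eqP/g0/gen_subgroupP.
  by rewrite Quotient.idealrBE reprK.
have FB : zmod_morphism F.
  move=> x y; have [[u ->] [v ->]] := (quot_proj_surj x, quot_proj_surj y).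
  by rewrite -raddfB !Fpi raddfB.
by exists (additive_of FB) => x; apply: Fpi.
Qed.

End Quotient.

Section Tensor.
Variables M N : gmodule gT.

Lemma tensDl (m1 m2 : M) (n : N) : tens (m1 + m2) n = tens m1 n + tens m2 n.
Proof.
apply/eqP; rewrite -subr_eq0 opprD addrA; apply/eqP.
have := quot_proj0 (@tensor_rel_stable _ M N) (tensor_rell m1 m2 n).
by rewrite 2!raddfB.
Qed.

Lemma tensDr (m : M) (n1 n2 : N) : tens m (n1 + n2) = tens m n1 + tens m n2.
Proof.
apply/eqP; rewrite -subr_eq0 opprD addrA; apply/eqP.
have := quot_proj0 (@tensor_rel_stable _ M N) (tensor_relr m n1 n2).
by rewrite 2!raddfB.
Qed.

Definition tensl n : {additive M -> tensor M N} :=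
  additive_of (zmod_morphismD (fun m1 m2 => tensDl m1 m2 n)).
Definition tensr m : {additive N -> tensor M N} :=
  additive_of (zmod_morphismD (tensDr m)).

Lemma tensor_ext (V : zmodType) (f g : {additive tensor M N -> V}) :
  (forall m n, f (tens m n) = g (tens m n)) -> f =1 g.
Proof.
move=> fg y; have [x ->] := quot_proj_surj y; move: x.
apply: (freeg_ext (V := V)
  (f := f \o @quot_proj _ _ (@tensor_rel_stable _ M N))
  (g := g \o @quot_proj _ _ (@tensor_rel_stable _ M N)))=> [||[m n]].
- by move=> x y'; rewrite /= !raddfB.
- by move=> x y'; rewrite /= !raddfB.
exact: fg.
Qed.

Lemma tensor_lift (V : zmodType) (b : M -> N -> V) :
  (forall n, {morph b^~ n : x y / x + y}) -> (forall m, {morph b m : x y / x + y}) ->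
  exists F : {additive tensor M N -> V}, forall m n, F (tens m n) = b m n.
Proof.
move=> bl br; have [F0 F0E] := free_lift (fun p : M * N => b p.1 p.2).
have F0E' m n : F0 (free_pair m n) = b m n by exact: F0E.
have [|F FE] := @quot_lift (free_prod M N) _ (@tensor_rel_stable _ M N) _ F0.
  by move=> _ [m1 m2 n|m n1 n2]; rewrite 2!raddfB !F0E' ?bl ?br addrAC addrK subrr.
by exists F => m n; rewrite [LHS]FE F0E'.
Qed.

End Tensor.
End AdditiveMaps.

(** * Bases and permutation lattices *)

Section Lattices.
Import GRing.Theory.
Local Open Scope ring_scope.

(** A family with its coordinate forms. Exhibiting the forms is the convenient way
    to prove that a family is a basis: they give existence of the coordinates and,
    by duality, their uniqueness. *)
Definition dual_family (V : zmodType) (J : finType) (b : J -> V)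
    (co : J -> {additive V -> int}) : Prop :=
  (forall x, x = \sum_j b j *~ co j x) /\
  (forall j k, co j (b k) = (j == k)%:R).

Lemma zbasis_dual_family (V : zmodType) (J : finType) (b : J -> V) co :
  dual_family b co -> is_zbasis (fun i : 'I_#|J| => b (enum_val i)).
Proof.
move=> [bE co_b] x; exists [ffun i => co (enum_val i) x]; split.
  rewrite {1}[x]bE (reindex_onto _ _ (fun j _ => enum_rankK j)) /=.
  by apply: eq_big => [i|i _]; rewrite ?enum_valK ?eqxx // ffunE.
move=> c ->; apply/ffunP => i; rewrite ffunE raddf_sum (bigD1 i) //= raddfMz co_b eqxx.
rewrite big1 ?addr0 ?intz // => k ki.
by rewrite raddfMz co_b (inj_eq enum_val_inj) eq_sym (negPf ki) mul0rz.
Qed.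

Variable gT : finGroupType.

Definition permutation_basis (M : gmodule gT) (J : finType) (b : J -> M) : Prop :=
  (exists co, dual_family b co) /\ forall j a, exists k, gmod_act M (b j) a = b k.

Lemma permutation_latticeP (M : gmodule gT) (J : finType) (b : J -> M) :
  permutation_basis b -> is_permutation_lattice M.
Proof.
case=> [[co b_co] b_act]; exists #|J|, (fun i => b (enum_val i)); split.
  exact: zbasis_dual_family b_co.
move=> i a; have [k ->] := b_act (enum_val i) a.
by exists (enum_rank k); rewrite enum_rankK.
Qed.

Section Product.
Variables M N : gmodule gT.

Lemma diag_actB a : zmod_morphism ((@diag_act gT M N)^~ a).
Proof. by move=> [x1 x2] [y1 y2]; congr pair; apply: gmod_actB. Qed.

Definition prod_gmodule : gmodule gT :=
  @GModule gT (M * N)%type (Action (@diag_act_is_action gT M N)) diag_actB.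

Definition sum_family (J K : finType) (b : J -> M) (c : K -> N) (i : J + K) :
  prod_gmodule := match i with inl j => (b j, 0) | inr k => (0, c k) end.

Lemma dual_family_prod (J K : finType) (b : J -> M) (c : K -> N) :
  (exists co, dual_family b co) -> (exists co, dual_family c co) ->
  exists co, dual_family (sum_family b c) co.
Proof.
move=> [bo [bE b_dual]] [co [cE c_dual]].
pose dual i : {additive prod_gmodule -> int} := match i with
  | inl j => bo j \o (fst : M * N -> M)
  | inr k => co k \o (snd : M * N -> N) end.
exists dual; split=> [[x y]|[j|k] [j'|k']] /=.
- rewrite big_sumType /=.
  have -> : (x, y) = (x, 0) + (0, y) :> prod_gmodule.
    by rewrite -[in LHS](addr0 x) -[in LHS](add0r y).
  congr (_ + _).
    have in1B : zmod_morphism (fun u : M => (u, 0) : prod_gmodule).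
      by move=> u v; congr pair; rewrite subr0.
    rewrite {1}[x]bE [LHS](raddf_sum (additive_of in1B)).
    by apply: eq_bigr => j _; rewrite raddfMz.
  have in2B : zmod_morphism (fun u : N => (0, u) : prod_gmodule).
    by move=> u v; congr pair; rewrite subr0.
  rewrite {1}[y]cE [LHS](raddf_sum (additive_of in2B)).
  by apply: eq_bigr => j _; rewrite raddfMz.
- exact: b_dual.
- exact: raddf0.
- exact: raddf0.
- exact: c_dual.
Qed.

Lemma permutation_basis_prod (J K : finType) (b : J -> M) (c : K -> N) :
  permutation_basis b -> permutation_basis c -> permutation_basis (sum_family b c).
Proof.
move=> [b_dual b_act] [c_dual c_act]; split; first exact: dual_family_prod.
move=> [j|k] a /=.
  have [j' bj'] := b_act j a; exists (inl j').
  by congr pair; [apply: bj' | apply: gmod_act0].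
have [k' ck'] := c_act k a; exists (inr k').
by congr pair; [apply: gmod_act0 | apply: ck'].
Qed.

End Product.

Section FunctionModule.
Variables (K : finType) (to : {action gT &-> K}).

(** Evaluating at the translate by the inverse makes the indicator function of a
    point follow the point, so that these functions form the permutation lattice
    on the given finite set. *)
Definition fun_act (f : {ffun K -> int}) (a : gT) := [ffun k => f (to k (a^-1)%g)].

Lemma fun_act_is_action : is_action [set: gT] fun_act.
Proof.
apply: is_total_action => [f|f a b]; apply/ffunP => k; rewrite !ffunE.
  by rewrite invg1 tact1.
by rewrite invMg tactM.
Qed.

Lemma fun_actB a : zmod_morphism (fun_act^~ a).
Proof. by move=> f g; apply/ffunP => k; rewrite !ffunE. Qed.

Definition fun_gmodule : gmodule gT :=
  @GModule gT {ffun K -> int} (Action fun_act_is_action) fun_actB.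

Lemma fun_actE (f : fun_gmodule) a k : (gmod_act fun_gmodule f a) (to k a) = f k.
Proof. by rewrite ffunE -tactM mulgV tact1. Qed.

Lemma fun_act_ext (f g : fun_gmodule) a :
  (forall k, f (to k a) = g k) -> f = gmod_act fun_gmodule g a.
Proof. by move=> fg; apply/ffunP => k; rewrite ffunE -fg -tactM mulVg tact1. Qed.

Definition fun_indicator (k : K) : fun_gmodule := [ffun l => (l == k)%:R].

Lemma fun_indicator_basis : permutation_basis fun_indicator.
Proof.
split.
  have evB k : zmod_morphism (fun f : fun_gmodule => f k) by move=> f g; rewrite !ffunE.
  exists (fun k => additive_of (evB k)); split=> [f|j k]; last by rewrite /= ffunE.
  apply/ffunP => k; rewrite [RHS](raddf_sum (additive_of (evB k))) (bigD1 k) //=.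
  rewrite [X in _ = X + _](raddfMz (additive_of (evB k))) /= ffunE eqxx intz.
  rewrite big1 ?addr0 //.
  move=> l lk; rewrite [LHS](raddfMz (additive_of (evB k))) /= ffunE.
  by rewrite eq_sym (negPf lk) mul0rz.
move=> k a; exists (to k a); apply/ffunP => l; rewrite !ffunE; congr (nat_of_bool _)%:R.
by apply/eqP/eqP => [<-|->]; rewrite -tactM ?mulgV ?mulVg tact1.
Qed.

End FunctionModule.

Definition trivial_act (K : finType) (k : K) (a : gT) := k.

Lemma trivial_act_is_action (K : finType) : is_action [set: gT] (@trivial_act K).
Proof. by apply: is_total_action. Qed.

Definition trivial_action (K : finType) : {action gT &-> K} :=
  Action (@trivial_act_is_action K).

End Lattices.

(** * The tensor square and the exterior square of A *)

Section SquaresOfA.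
Import GRing.Theory Num.Theory.
Local Open Scope ring_scope.

Variable m : nat.
Local Notation n := m.+1.
Local Notation A := (latticeA n).
Local Notation T := (tensor A A).
Local Notation L := (exterior_square A).

Definition coord (z : A) (i : 'I_n) : int := zsv_val z 0 i.

Lemma coordB i : zmod_morphism (coord^~ i).
Proof. by move=> x y; rewrite /coord /= !mxE. Qed.

Lemma coordD (x y : A) i : coord (x + y) i = coord x i + coord y i.
Proof. by rewrite /coord /= !mxE. Qed.

Lemma coord_act z s i : coord (gmod_act A z s) (s i) = coord z i.
Proof. exact: zsv_actE. Qed.

Lemma sum_coord z : \sum_i coord z i = 0.
Proof. by apply/eqP; have := zsv_valP z; rewrite inE. Qed.

Lemma root_zero_sum (i : 'I_m) :
  (delta_mx 0 (lift ord0 i) - delta_mx 0 ord0 : 'rV[int]_n) \in @zero_sum n.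
Proof.
have sum1 (a : 'I_n) : \sum_j ((j == a)%:R : int) = 1.
  by rewrite (bigD1 a) //= eqxx big1 // => j /negPf ->.
by rewrite inE; under eq_bigr do rewrite !mxE /=; rewrite sumrB !sum1 subrr.
Qed.

Definition root (i : 'I_m) : A := ZeroSumVector (root_zero_sum i).

Lemma coord_root i j : coord (root i) j = (j == lift ord0 i)%:R - (j == ord0)%:R.
Proof. by rewrite /coord !mxE /=. Qed.

(** The coordinate at 0 of a zero-sum vector is minus the sum of the others, so
    the roots e_i - e_0 form a basis. *)
Lemma root_expansion z : z = \sum_i root i *~ coord z (lift ord0 i).
Proof.
apply/val_inj/rowP => j; rewrite -![zsv_val _ 0 j]/(coord _ j).
rewrite [RHS](raddf_sum (additive_of (coordB j))).
under eq_bigr do rewrite raddfMz /= coord_root.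
have [k ->|->] := unliftP ord0 j.
  rewrite (bigD1 k) //= eqxx subr0 intz big1 ?addr0 // => i ik.
  by rewrite (inj_eq lift_inj) eq_sym (negPf ik) subr0 mul0rz.
have := sum_coord z; rewrite big_ord_recl => /eqP; rewrite addr_eq0 => /eqP ->.
rewrite -sumrN; apply: eq_bigr => i _.
by rewrite (negPf (neq_lift _ _)) eqxx sub0r mulNrz intz.
Qed.

(** A tensor z (x) w is recorded by the matrix of the products z_i w_j. All later
    computations in the tensor square take place on this matrix. *)
Lemma entries_subproof : exists F : {additive T -> 'M[int]_n},
  forall z w, F (tens z w) = \matrix_(i, j) (coord z i * coord w j).
Proof.
apply: tensor_lift => [w x y|z x y]; apply/matrixP => i j.
  by rewrite !mxE coordD mulrDl.
by rewrite !mxE coordD mulrDr.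
Qed.

Definition entries : {additive T -> 'M[int]_n} := projT1 (cid entries_subproof).

Lemma entries_tens z w i j : entries (tens z w) i j = coord z i * coord w j.
Proof. by rewrite /entries; case: cid => F /= ->; rewrite mxE. Qed.

Lemma entryB i j : zmod_morphism (fun x => entries x i j).
Proof. by move=> x y; rewrite raddfB !mxE. Qed.
Definition entry i j : {additive T -> int} := additive_of (entryB i j).

Lemma entry_tens z w i j : entry i j (tens z w) = coord z i * coord w j.
Proof. exact: entries_tens. Qed.

Lemma entry_act x (s : 'S_n) i j : entry (s i) (s j) (gmod_act T x s) = entry i j x.
Proof.
have actB : zmod_morphism (fun x => entry (s i) (s j) (gmod_act T x s)).
  by move=> u v; rewrite gmod_actB raddfB.
move: x; apply: (tensor_ext (f := additive_of actB)) => z w.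
by rewrite [LHS](congr1 (entry (s i) (s j)) (tens_act z w s)) !entry_tens !coord_act.
Qed.

Lemma sum_row x i : \sum_j entry i j x = 0.
Proof.
move: x; apply: (tensor_ext (f := additive_of (sum_zmod_morphism _)) (g := \0)) => z w /=.
by under eq_bigr do rewrite entries_tens; rewrite -mulr_sumr sum_coord mulr0.
Qed.

Lemma sum_col x j : \sum_i entry i j x = 0.
Proof.
move: x; apply: (tensor_ext (f := additive_of (sum_zmod_morphism _)) (g := \0)) => z w /=.
by under eq_bigr do rewrite entries_tens; rewrite -mulr_suml sum_coord mul0r.
Qed.

Definition root_tens (p : 'I_m * 'I_m) : T := tens (root p.1) (root p.2).
Definition inner_entry (p : 'I_m * 'I_m) : {additive T -> int} :=
  entry (lift ord0 p.1) (lift ord0 p.2).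

(** Both sides are additive in x, so that it suffices to expand a pure tensor in the
    basis of roots. *)
Lemma tens_expansion x : x = \sum_p root_tens p *~ inner_entry p x.
Proof.
have rB : zmod_morphism (fun x => \sum_p root_tens p *~ inner_entry p x).
  by move=> u v; rewrite -sumrB; apply: eq_bigr => p _; rewrite raddfB mulrzBr.
move: x; apply: (tensor_ext (f := idfun) (g := additive_of rB)) => z w /=.
rewrite {1}[z]root_expansion [LHS](raddf_sum (tensl _ w)) -(pair_bigA _ (fun i j =>
  root_tens (i, j) *~ inner_entry (i, j) (tens z w))) /=; apply: eq_bigr => i _.
rewrite [LHS](raddfMz (tensl A w)) /= {1}[w]root_expansion.
rewrite [tens _ _](raddf_sum (tensr _ (root i))).
rewrite mulrz_suml; apply: eq_bigr => j _.
by rewrite [X in X *~ _](raddfMz (tensr A (root i))) -mulrzA /= entries_tens mulrC.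
Qed.

Lemma tens_dual_family : dual_family root_tens inner_entry.
Proof.
split; first exact: tens_expansion.
move=> [i j] [k l]; rewrite entry_tens !coord_root !(inj_eq lift_inj) /=.
by rewrite !subr0 -natrM mulnb.
Qed.

Lemma tens_lattice : is_lattice T.
Proof. by eexists; eexists; apply: zbasis_dual_family tens_dual_family. Qed.

Definition wedge_proj : {additive T -> L} :=
  additive_of (@quot_projB _ T _ (@tensor_square_stable _ A)).

(** The map z /\ w |-> z (x) w - w (x) z; it is well defined since it kills z (x) z. *)
Lemma antisym_subproof : exists F : {additive L -> T},
  forall z w, F (wedge_proj (tens z w)) = tens z w - tens w z.
Proof.
have [||D DE] := @tensor_lift _ A A T (fun z w => tens z w - tens w z).
- by move=> w x y; rewrite tensDl tensDr opprD addrACA.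
- by move=> w x y; rewrite tensDl tensDr opprD addrACA.
have [|F FE] := @quot_lift _ T _ (@tensor_square_stable _ A) _ D.
  by move=> _ [z ->]; rewrite DE subrr.
by exists F => z w; rewrite FE DE.
Qed.

Definition antisym : {additive L -> T} := projT1 (cid antisym_subproof).

Lemma antisymE z w : antisym (wedge_proj (tens z w)) = tens z w - tens w z.
Proof. by rewrite /antisym; case: cid. Qed.

Lemma wedge_proj_surj y : exists x, y = wedge_proj x.
Proof. exact: quot_proj_surj. Qed.

Lemma antisym_equivariant : equivariant antisym.
Proof.
move=> y s; have [x ->] := wedge_proj_surj y.
rewrite -[gmod_act L _ _](quot_proj_act (@tensor_square_stable _ A)) -/(wedge_proj _).
have fB : zmod_morphism (fun x => antisym (wedge_proj (gmod_act T x s))).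
  by move=> u v; rewrite gmod_actB 2!raddfB.
have gB : zmod_morphism (fun x => gmod_act T (antisym (wedge_proj x)) s).
  by move=> u v; rewrite 2!raddfB gmod_actB.
move: x; apply: (tensor_ext (f := additive_of fB) (g := additive_of gB)) => z w.
rewrite [LHS](congr1 (antisym \o wedge_proj) (tens_act z w s)) [LHS]antisymE.
by rewrite [RHS](congr1 (fun y => gmod_act T y s) (antisymE z w)) gmod_actB !tens_act.
Qed.

Lemma entry_antisym x i j :
  entry i j (antisym (wedge_proj x)) = entry i j x - entry j i x.
Proof.
have fB : zmod_morphism (fun x => entry i j (antisym (wedge_proj x))).
  by move=> u v; rewrite !raddfB.
have gB : zmod_morphism (fun x => entry i j x - entry j i x).
  by move=> u v; rewrite !raddfB addrACA.
move: x; apply: (tensor_ext (f := additive_of fB) (g := additive_of gB)) => z w /=.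
by rewrite antisymE raddfB !mxE !entries_tens; ring.
Qed.

Definition lt_pairs k : {pred 'I_k * 'I_k} := fun p => (p.1 < p.2)%N.

Lemma big_sym_pairs (V : zmodType) k (F : 'I_k * 'I_k -> V) :
  \sum_p F p = \sum_i F (i, i) +
    \sum_(p : {p in @lt_pairs k}) (F (val p) + F ((val p).2, (val p).1)).
Proof.
rewrite (bigID (fun p => p.1 == p.2)) /=; congr (_ + _).
  rewrite (reindex_onto (fun i => (i, i)) fst) /=.
    by apply: eq_bigl => i; rewrite !eqxx.
  by case=> i j /= /eqP ->.
rewrite -(big_sub (@lt_pairs k) (fun p => F p + F (p.2, p.1))) big_split /=.
rewrite (bigID (@lt_pairs k)) /=; congr (_ + _).
  by apply: eq_bigl => -[i j]; rewrite unfold_in /lt_pairs /= -val_eqE /=; lia.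
rewrite (reindex_onto (fun p => (p.2, p.1)) (fun p => (p.2, p.1))) /=; last by case.
by apply: eq_bigl => -[i j]; rewrite !unfold_in /lt_pairs /= eqxx -val_eqE /=; lia.
Qed.

Definition root_wedge (p : {p in @lt_pairs m}) : L := wedge_proj (root_tens (val p)).
Definition wedge_entry (p : {p in @lt_pairs m}) : {additive L -> int} :=
  inner_entry (val p) \o antisym.

Lemma wedge_entryE p x : wedge_entry p (wedge_proj x) =
  inner_entry (val p) x - inner_entry ((val p).2, (val p).1) x.
Proof. exact: entry_antisym. Qed.

(** In the image of the expansion of a tensor the diagonal terms vanish, and the
    terms of index (i, j) and (j, i) are opposite; what remains of the coefficients
    is the antisymmetric part of the matrix of entries. *)
Lemma wedge_expansion y : y = \sum_p root_wedge p *~ wedge_entry p y.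
Proof.
have sq0 z : wedge_proj (tens z z) = 0 by apply: quot_proj0; exists z.
have antiC z w : wedge_proj (tens w z) = - wedge_proj (tens z w).
  apply/eqP; rewrite -addr_eq0; apply/eqP; rewrite -[RHS](sq0 (z + w)).
  have projD u v : wedge_proj (u + v) = wedge_proj u + wedge_proj v by apply: raddfD.
rewrite (tensDl z w) (tensDr z) (tensDr w) !projD 2!sq0.
by rewrite add0r addr0 addrC.
have [x ->] := wedge_proj_surj y.
rewrite {1}[x]tens_expansion raddf_sum big_sym_pairs big1 ?add0r => [|i _]; last first.
  by rewrite raddfMz /root_tens /= sq0 mul0rz.
apply: eq_bigr => p _.
by rewrite wedge_entryE mulrzBr 2!(raddfMz wedge_proj) -mulNrz -antiC.
Qed.

Lemma wedge_dual_family : dual_family root_wedge wedge_entry.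
Proof.
split; first exact: wedge_expansion.
move=> p q; rewrite [LHS]wedge_entryE !tens_dual_family.2 val_eqE.
suff -> : ((val p).2, (val p).1) == val q = false by rewrite subr0.
case: p q => [[i j] ij] [[k l] kl]; rewrite xpair_eqE -!val_eqE /=.
by move: ij kl; rewrite !unfold_in /lt_pairs /=; lia.
Qed.

Lemma wedge_lattice : is_lattice L.
Proof. by eexists; eexists; apply: zbasis_dual_family wedge_dual_family. Qed.

(** The coordinates of the exterior square are read off the antisymmetrization. *)
Lemma antisym_inj : injective antisym.
Proof.
apply: raddf_inj => y y0; rewrite [y]wedge_expansion big1 // => p _.
have -> : wedge_entry p y = 0; last exact: mulr0z.
by rewrite -[RHS](raddf0 (inner_entry (val p))) -y0.
Qed.

(** The polar form of the quadratic form that x represents in the symmetric square;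
    since the integers have no 2-torsion, it determines that quadratic form. *)
Definition polar i j x : int := entry i j x + entry j i x.

Lemma polar_antisym y i j : polar i j (antisym y) = 0.
Proof. by have [x ->] := wedge_proj_surj y; rewrite /polar !entry_antisym; ring. Qed.

(** The kernel of the projection of the tensor square onto the symmetric square:
    if the entries of x are antisymmetric, then grouping the terms (i, j) and (j, i)
    of its expansion writes it as an antisymmetrization. *)
Lemma polar0_antisym x : (forall i j, polar i j x = 0) -> exists y, x = antisym y.
Proof.
move=> x0; exists (\sum_p root_wedge p *~ inner_entry (val p) x).
rewrite {1}[x]tens_expansion raddf_sum big_sym_pairs big1 ?add0r => [|i _]; last first.
  have /eqP := x0 (lift ord0 i) (lift ord0 i); rewrite /polar -mulr2n mulrn_eq0 /=.
  by move=> /eqP xii; rewrite -[X in _ *~ X]/(entries x _ _) xii mulr0z.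
apply: eq_bigr => -[[i j] ltij] _; rewrite raddfMz /= antisymE mulrzBl; congr (_ + _).
rewrite /inner_entry /= -mulrNz; congr (_ *~ _); apply/eqP; rewrite -addr_eq0.
by have /= := x0 (lift ord0 j) (lift ord0 i); rewrite /polar /= => ->.
Qed.

(** A description of the symmetric square of A inside the symmetric matrices. An
    element with prescribed polar form is written in the basis of roots, with the
    upper triangular part of M and half its diagonal as coefficients; the entries
    with an index 0 agree as well, since the rows have sum zero on both sides. *)
Lemma polar_surj (M : 'I_n -> 'I_n -> int) (d : 'I_n -> int) :
  (forall i j, M i j = M j i) -> (forall i, M i i = d i *+ 2) ->
  (forall i, \sum_j M i j = 0) ->
  exists x, forall i j, polar i j x = M i j.
Proof.
move=> MC Md M0.
pose c (p : 'I_m * 'I_m) := if (p.1 < p.2)%N then M (lift ord0 p.1) (lift ord0 p.2)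
  else if p.1 == p.2 then d (lift ord0 p.1) else 0.
exists (\sum_p root_tens p *~ c p); set x := \sum_p _.
have xij k l : entry (lift ord0 k) (lift ord0 l) x = c (k, l).
  rewrite -[LHS]/(inner_entry (k, l) x) raddf_sum (bigD1 (k, l)) //= big1 ?addr0.
    by rewrite [LHS](raddfMz (inner_entry (k, l))) tens_dual_family.2 eqxx intz.
  move=> p pkl; rewrite [LHS](raddfMz (inner_entry (k, l))) tens_dual_family.2.
  by rewrite eq_sym (negPf pkl) mul0rz.
have pC i j : polar i j x = polar j i x by rewrite /polar addrC.
have p0 i : \sum_j polar i j x = 0 by rewrite big_split /= sum_row sum_col.
have inner k l : polar (lift ord0 k) (lift ord0 l) x = M (lift ord0 k) (lift ord0 l).
  rewrite /polar !xij /c /= [l == k]eq_sym; case: ltngtP => kl.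
  - by rewrite -val_eqE /= ltn_eqF ?addr0.
  - by rewrite -val_eqE /= gtn_eqF // add0r MC.
  by rewrite (val_inj kl) eqxx Md mulr2n.
have left k : polar (lift ord0 k) ord0 x = M (lift ord0 k) ord0.
  have := etrans (p0 (lift ord0 k)) (esym (M0 (lift ord0 k))); rewrite !big_ord_recl.
  by under eq_bigr do rewrite inner; apply: addIr.
move=> i j; have [k ->|->] := unliftP ord0 i.
  by have [l ->|->] := unliftP ord0 j.
have [l ->|->] := unliftP ord0 j; first by rewrite pC MC left.
have := etrans (p0 ord0) (esym (M0 ord0)); rewrite !big_ord_recl.
by under eq_bigr do rewrite pC left -MC; apply: addIr.
Qed.

End SquaresOfA.
Arguments antisym {m}.

(** * Equivalence from the symmetric square *)

Section Criterion.
Import GRing.Theory Num.Theory.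
Local Open Scope ring_scope.

Variable m : nat.
Local Notation n := m.+1.
Local Notation A := (latticeA n).
Local Notation T := (tensor A A).
Local Notation L := (exterior_square A).

(** It suffices to make the symmetric square stably permutation: the hypotheses on
    phi and psi say that they induce an isomorphism of Sym^2 A (+) P with Q. Then E is
    the sum of the tensor square and P, with quotient P modulo the tensor square and
    quotient Q modulo the exterior square embedded by antisymmetrization. *)
Lemma squares_equiv (P Q : gmodule 'S_n) (J K : finType) (b : J -> P) (c : K -> Q)
    (phi : {additive T -> Q}) (psi : {additive P -> Q}) :
  permutation_basis b -> permutation_basis c ->
  equivariant phi -> equivariant psi ->
  (forall y, phi (antisym y) = 0) ->
  (forall x u, phi x + psi u = 0 -> u = 0 /\ forall i j, polar i j x = 0) ->
  (forall q, exists x u, q = phi x + psi u) ->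
  lattice_equiv L T.
Proof.
move=> b_perm c_perm phi_eq psi_eq phi0 ker surj.
split; [exact: wedge_lattice | exact: tens_lattice |].
pose E := prod_gmodule T P.
exists E, Q, P; split.
- have [co b_dual] := dual_family_prod (ex_intro _ _ (@tens_dual_family m)) b_perm.1.
  by do 2 eexists; apply: zbasis_dual_family b_dual.
- exact: permutation_latticeP c_perm.
- exact: permutation_latticeP b_perm.
- have fB : zmod_morphism (fun y => (antisym y, 0) : E).
    by move=> y z; rewrite raddfB; congr pair; rewrite subr0.
  have gB : zmod_morphism (fun v : E => phi v.1 + psi v.2).
    by move=> [x u] [y v] /=; rewrite !raddfB opprD addrACA.
  exists (additive_of fB), (additive_of gB); split.
  + move=> y a; congr pair; first exact: antisym_equivariant.
    by rewrite gmod_act0.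
  + move=> [x u] a; rewrite [RHS]gmod_actD.
    by congr (_ + _); [apply: phi_eq | apply: psi_eq].
  + by move=> y z /(congr1 fst); apply: antisym_inj.
  + move=> [x u]; split=> [/ker [u0 /polar0_antisym [y xE]]|[y yE]].
      by exists y; rewrite (u0 : u = 0) (xE : x = antisym y).
    rewrite /= (congr1 fst yE : x = antisym y) (congr1 snd yE : u = 0).
    by rewrite phi0 raddf0 addr0.
  by move=> q; have [x [u ->]] := surj q; exists (x, u).
have fB : zmod_morphism (fun x => (x, 0) : E).
  by move=> y z; congr pair; rewrite subr0.
have gB : zmod_morphism (fun v : E => v.2) by [].
exists (additive_of fB), (additive_of gB); split=> //.
- by move=> y a; congr pair; rewrite gmod_act0.
- by move=> y z /(congr1 fst).
- move=> [x u]; split=> [u0|[y /(congr1 snd)] //]; exists x.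
  by rewrite (u0 : u = 0).
by move=> u; exists (0, u).
Qed.

(** The value at the indicator vector of S of the quadratic form represented by x. *)
Definition quad (S : {set 'I_n}) x := \sum_(i in S) \sum_(j in S) entry i j x.

Lemma quadB S : zmod_morphism (quad S).
Proof.
move=> x y; rewrite -sumrB; apply: eq_bigr => i _.
by rewrite -sumrB; apply: eq_bigr => j _; rewrite raddfB.
Qed.

Lemma quad_act x (s : 'S_n) (S : {set 'I_n}) : quad (s @: S) (gmod_act T x s) = quad S x.
Proof.
rewrite /quad big_imset => [|i j _ _]; last exact: perm_inj.
apply: eq_bigr => i _; rewrite big_imset => [|j k _ _]; last exact: perm_inj.
by apply: eq_bigr => j _; rewrite entry_act.
Qed.

Lemma quad1 i x : quad [set i] x = entry i i x.
Proof. by rewrite /quad !big_set1. Qed.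

Lemma quad2 i j x : i != j ->
  quad [set i; j] x = entry i i x + entry j j x + polar i j x.
Proof.
move=> ij; have sum2 F : \sum_(k in [set i; j]) F k = F i + F j :> int.
  by rewrite big_setU1 ?inE // big_set1.
by rewrite /quad !sum2 /polar; ring.
Qed.

(** The quadratic form factors through the quotient by the vector (1, ..., 1), where
    the indicator vectors of S and of its complement are opposite. *)
Lemma quadC S x : quad (~: S) x = quad S x.
Proof.
have splitr i : \sum_(j in S) entry i j x = - \sum_(j in ~: S) entry i j x.
  apply/eqP; rewrite -addr_eq0; apply/eqP.
  rewrite -[RHS](sum_row x i) [RHS](bigID (mem S)) /=.
  by congr (_ + _); apply: eq_bigl => j; rewrite inE.
rewrite /quad [RHS](eq_bigr _ (fun i _ => splitr i)) sumrN [in RHS]exchange_big /=.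
rewrite [LHS]exchange_big /= -sumrN; apply: eq_bigr => j _.
apply/eqP; rewrite -addr_eq0 addrC; apply/eqP.
rewrite -[RHS](sum_col x j) [RHS](bigID (mem S)) /=.
by congr (_ + _); apply: eq_bigl => i; rewrite inE.
Qed.

(** An alternating form vanishes on the diagonal. *)
Lemma quad_antisym S y : quad S (antisym y) = 0.
Proof.
have : quad S (antisym y) *+ 2 = 0.
  rewrite mulr2n /quad {2}exchange_big -big_split; apply: big1 => i _.
  by rewrite -big_split; apply: big1 => j _; apply: polar_antisym.
by move/eqP; rewrite mulrn_eq0 => /eqP.
Qed.

End Criterion.

(** * The case n = 2 *)

Section Cases.
Import GRing.Theory Num.Theory.
Local Open Scope ring_scope.

(** For n = 2 the symmetric square is the trivial lattice of rank one, hence already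
    a permutation lattice. *)
Lemma squares_equiv_A1 :
  lattice_equiv (exterior_square (latticeA 2))
                (tensor (latticeA 2) (latticeA 2)).
Proof.
pose P := fun_gmodule (trivial_action 'S_2 void).
pose Q := fun_gmodule (trivial_action 'S_2 unit).
pose T := tensor (latticeA 2) (latticeA 2).
pose phi0 (x : T) : Q := [ffun _ => quad [set ord0] x].
have phiB : zmod_morphism phi0 by move=> x y; apply/ffunP => t; rewrite !ffunE quadB.
have psiB : zmod_morphism (fun _ : P => 0 : Q) by move=> x y; rewrite subrr.
have antiphi y : phi0 (antisym y) = 0 by apply/ffunP => t; rewrite !ffunE quad_antisym.
have Ient (i : 'I_2) : i = ord0 \/ i = lift ord0 ord0.
  by have [k ->|] := unliftP ord0 i; [right; rewrite (ord1 k) | left].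
have rows (x : T) (i : 'I_2) : entry i (lift ord0 ord0) x = - entry i ord0 x.
  have := sum_row x i; rewrite !big_ord_recl big_ord0 addr0 addrC => /eqP.
  by rewrite addr_eq0 => /eqP.
have cols (x : T) (i : 'I_2) : entry (lift ord0 ord0) i x = - entry ord0 i x.
  have := sum_col x i; rewrite !big_ord_recl big_ord0 addr0 addrC => /eqP.
  by rewrite addr_eq0 => /eqP.
apply: (squares_equiv (fun_indicator_basis _) (fun_indicator_basis _)
  (phi := additive_of phiB) (psi := additive_of psiB)) => //.
- move=> x s; apply: fun_act_ext => t; rewrite !ffunE !quad1 -(entry_act x s).
  case: (Ient (s ord0)) => -> //; by rewrite rows cols opprK.
- by move=> u s; apply: fun_act_ext => t; rewrite !ffunE.
- move=> x u /ffunP/(_ tt); rewrite !ffunE addr0 quad1 => x0.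
  split=> [|i j]; first by apply/ffunP => -[].
  rewrite /polar; case: (Ient i) (Ient j) => -> [] ->;
    by rewrite ?rows ?cols ?rows x0 ?oppr0.
move=> q; pose M (i j : 'I_2) : int := (if i == j then 1 else -1) * q tt *+ 2.
have [||i|x xM] := @polar_surj 1 M (fun _ => q tt).
- by move=> i j; rewrite /M eq_sym.
- by move=> i; rewrite /M eqxx mul1r.
- by rewrite !big_ord_recl big_ord0 /M; case: (Ient i) => -> /=; ring.
exists x, 0; apply/ffunP => -[]; rewrite !ffunE quad1 addr0.
have := xM ord0 ord0; rewrite /M eqxx /polar mul1r.
by move: (entry _ _ _) (q tt) => a b; lia.
Qed.

End Cases.

(** * The odd case *)

Section SmallSubsets.
Variable n : nat.

Definition small_subset : {pred {set 'I_n}} := fun S => (0 < #|S| <= 2)%N.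

Lemma small_subset_imset (S : {set 'I_n}) (s : 'S_n) :
  S \in small_subset -> s @: S \in small_subset.
Proof. by rewrite !unfold_in card_imset //; apply: perm_inj. Qed.

Definition small_subset_act (S : {S | S \in small_subset}) (s : 'S_n) :
  {S | S \in small_subset} :=
  exist (fun S => S \in small_subset) _ (small_subset_imset s (valP S)).

Lemma small_subset_act_is_action : is_action [set: 'S_n] small_subset_act.
Proof.
apply: is_total_action => [S|S s t]; apply/val_inj/setP => i /=.
  by rewrite (eq_imset _ (@perm1 _)) imset_id.
by rewrite -imset_comp; congr (i \in pred_of_set _); apply: eq_imset => j; rewrite permM.
Qed.

Definition small_subset_action : {action 'S_n &-> {S | S \in small_subset}} :=
  Action small_subset_act_is_action.

Lemma set1_small i : [set i] \in small_subset.
Proof. by rewrite unfold_in cards1. Qed.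

Lemma set2_small i j : [set i; j] \in small_subset.
Proof. by rewrite unfold_in cards2; case: (i != j). Qed.

Definition small_subset1 i : {S | S \in small_subset} :=
  exist (fun S => S \in small_subset) _ (set1_small i).
Definition small_subset2 i j : {S | S \in small_subset} :=
  exist (fun S => S \in small_subset) _ (set2_small i j).

Lemma small_subsetP S : S \in small_subset ->
  (exists i, S = [set i]) \/ (exists i j, i != j /\ S = [set i; j]).
Proof.
rewrite unfold_in => /andP[S_gt0 S_le2]; have [cS|cS] : #|S| = 1%N \/ #|S| = 2 by lia.
  by left; apply/cards1P; rewrite cS.
have /cards2P [i [j [ij ->]]] : #|S| == 2 by rewrite cS.
by right; exists i, j.
Qed.

End SmallSubsets.

Section OddCase.
Import GRing.Theory Num.Theory.
Local Open Scope ring_scope.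

Lemma sum_delta n (i : 'I_n) (f : 'I_n -> int) c :
  \sum_j (f j + (if i == j then c else 0)) = \sum_j f j + c.
Proof.
rewrite big_split /= -big_mkcond; congr (_ + _).
by apply: big_pred1 => j; rewrite eq_sym.
Qed.

Lemma natr_odd p : (p.*2.+1)%:R = p%:R * 2 + 1 :> int.
Proof. by rewrite -addn1 natrD -muln2 natrM. Qed.

Lemma sum_shift p (i : 'I_(p.*2.+1)) (u : 'I_(p.*2.+1) -> int) :
  \sum_j (u i + u j) = (p%:R * 2 + 1) * u i + \sum_j u j.
Proof.
rewrite big_split /= sumr_const card_ord; congr (_ + _).
by rewrite -[LHS]mulr_natl natr_odd.
Qed.

(** The two lemmas that follow are the linear algebra of the odd case. Here d and B are
    the diagonal and the polar form of an element of the symmetric square, and the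
    equations express that its image vanishes. Summing a row of B gives u i = 0. *)
Lemma odd_kernel p (n := (p.*2).+1) (d u : 'I_n -> int) k (B : 'I_n -> 'I_n -> int) :
  (forall i, d i - p%:R * u i + k = 0) ->
  (forall i j, i != j -> d i + d j + B i j + (1 - p%:R) * (u i + u j) + 2 * k = 0) ->
  (forall i, B i i = d i + d i) ->
  \sum_i u i + 2 * k = 0 -> (forall i, \sum_j B i j = 0) ->
  [/\ forall i, u i = 0, k = 0 & forall i j, B i j = 0].
Proof.
move=> diag off Bd total rows.
have dE i : d i = p%:R * u i - k.
  by apply/eqP; rewrite -subr_eq0; apply/eqP; rewrite -[RHS](diag i); ring.
have BE i j : B i j = - (u i + u j) + (if i == j then 2 * d i + 2 * u i else 0).
  have [<-|ij] := eqVneq i j; first by rewrite Bd; ring.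
  apply/eqP; rewrite -subr_eq0; apply/eqP; rewrite -[RHS](off i j ij) !dE; ring.
have u0 i : u i = 0.
  rewrite -[RHS](rows i) (eq_bigr _ (fun j _ => BE i j)) sum_delta sumrN sum_shift dE.
  have -> : \sum_j u j = - (2 * k) by apply/eqP; rewrite -addr_eq0 total.
  ring.
have k0 : k = 0 by move: total; rewrite big1 //; lia.
by split=> // i j; rewrite BE !dE !u0 k0; case: eqP => _; ring.
Qed.

(** The inverse of the isomorphism of the odd case. Summing over a row the equations
    for the pairs {i, j} determines u i; then k is half of r minus the sum of u, and
    this is an integer because n is odd. *)
Lemma odd_surj p (n := (p.*2).+1) (q1 : 'I_n -> int) (r : int)
    (q2 : 'I_n -> 'I_n -> int) :
  (forall i j, q2 i j = q2 j i) ->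
  exists (u : 'I_n -> int) (k : int) (M : 'I_n -> 'I_n -> int) (d : 'I_n -> int),
  [/\ forall i j, M i j = M j i, forall i, M i i = d i *+ 2,
      forall i, \sum_j M i j = 0 &
  [/\ forall i, q1 i = d i - p%:R * u i + k,
      forall i j, i != j ->
        q2 i j = d i + d j + M i j + (1 - p%:R) * (u i + u j) + 2 * k &
      r = \sum_i u i + 2 * k]].
Proof.
move=> q2C.
pose h i j := if i == j then 0 else q2 i j - q1 i - q1 j.
have hC i j : h i j = h j i by rewrite /h eq_sym q2C; case: eqP => // _; ring.
(* Halving the off-diagonal sum is what makes k an integer below. *)
have [e he] : exists e, \sum_i \sum_j h i j = 2 * e.
  rewrite pair_bigA /= (big_sym_pairs (fun p => h p.1 p.2)) big1 => [|i _]; last first.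
    by rewrite /h eqxx.
  exists (\sum_(p : {p in @lt_pairs n}) h (val p).1 (val p).2).
  rewrite add0r mulr_sumr; apply: eq_bigr => -[[i j] ij] _ /=.
  by rewrite (hC j i) -mulr2n mulr_natl.
pose u i := r - 2 * q1 i - \sum_j h i j.
pose k := - p%:R * r + \sum_i q1 i + e.
pose d i := q1 i + p%:R * u i - k.
pose M i j := h i j - (u i + u j) + (if i == j then 2 * d i + 2 * u i else 0).
have uE : \sum_i u i + 2 * k = r.
  have sum_r : \sum_(i < n) r = (p%:R * 2 + 1) * r.
    by rewrite sumr_const card_ord -[LHS]mulr_natl natr_odd.
  by rewrite /u !sumrB sum_r he -mulr_sumr /k; ring.
exists u, k, M, d; split.
- move=> i j; rewrite /M hC eq_sym; case: eqP => [->|_]; ring.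
- by move=> i; rewrite /M /h eqxx -mulr_natl; ring.
- move=> i; rewrite sum_delta sumrB sum_shift.
  have -> : \sum_j h i j = r - 2 * q1 i - u i by rewrite /u; ring.
  have -> : \sum_j u j = r - 2 * k by rewrite -uE; ring.
  by rewrite /d; ring.
split=> [i|i j ij|]; rewrite ?uE //; first by rewrite /d; ring.
by rewrite /M /h /d (negPf ij); ring.
Qed.

(** For n = 2p + 1, the lattice Sym^2 A (+) Z^n (+) Z is isomorphic to the permutation
    lattice on the subsets of size 1 and 2, plus Z. Indeed e_i e_j |-> e_i + e_j maps
    Sym^2 Z^n onto the lattice D of vectors of even sum, with kernel Sym^2 A. This
    surjection has an equivariant section for n odd, and D (+) Z is isomorphic to
    Z^n (+) Z because (1, ..., 1) has odd sum. The map psi is the composite of this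
    isomorphism with the section, simplified by equivariant changes of coordinates. *)
Lemma squares_equiv_odd p (n := (p.*2).+1) :
  lattice_equiv (exterior_square (latticeA n)) (tensor (latticeA n) (latticeA n)).
Proof.
pose T := tensor (latticeA n) (latticeA n).
pose X := fun_gmodule 'P : gmodule 'S_n.
pose Z := fun_gmodule (trivial_action 'S_n unit).
pose Y := fun_gmodule (small_subset_action n).
pose P := prod_gmodule X Z.
pose Q := prod_gmodule Y Z.
pose phi0 (x : T) : Q := ([ffun S => quad (val S) x], 0).
pose psi0 (u : P) : Q :=
  ([ffun S : {S | S \in @small_subset n} =>
      (#|val S|%:R - 1 - p%:R) * (\sum_(i in val S) u.1 i) +
      #|val S|%:R * u.2 tt : int] : Y,
   [ffun _ : unit => \sum_i u.1 i + 2 * u.2 tt : int] : Z).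
have phiB : zmod_morphism phi0.
  move=> x y; congr pair; last by rewrite subr0.
  by apply/ffunP => S; rewrite !ffunE quadB.
have psiB : zmod_morphism psi0.
  have sB (D : pred 'I_n) (u v : P) : \sum_(i | D i) (u - v).1 i =
      \sum_(i | D i) u.1 i - \sum_(i | D i) v.1 i.
    by rewrite -sumrB; apply: eq_bigr => i _; rewrite !ffunE.
  move=> u v; congr pair; apply/ffunP => S; rewrite !ffunE.
    by rewrite [X in _ * X + _ = _](sB (mem (val S))) /=; ring.
  by rewrite [X in X + _ = _](sB predT) /=; ring.
have sum_act (D : {set 'I_n}) (u : X) (s : 'S_n) :
    \sum_(i in s @: D) gmod_act X u s i = \sum_(i in D) u i.
  rewrite big_imset => [|i j _ _]; last exact: perm_inj.
  by apply: eq_bigr => i _; apply: fun_actE.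
have b_perm := permutation_basis_prod (fun_indicator_basis ('P : {action 'S_n &-> 'I_n}))
  (fun_indicator_basis (trivial_action 'S_n unit)).
have c_perm := permutation_basis_prod (fun_indicator_basis (small_subset_action n))
  (fun_indicator_basis (trivial_action 'S_n unit)).
apply: (squares_equiv b_perm c_perm (phi := additive_of phiB) (psi := additive_of psiB)).
- move=> x s; congr pair; last by apply/ffunP => t; rewrite !ffunE.
  by apply: fun_act_ext => S; rewrite !ffunE quad_act.
- move=> u s; congr pair; apply: fun_act_ext => S; rewrite ![LHS]ffunE ![RHS]ffunE.
    rewrite card_imset; last exact: perm_inj.
    by rewrite sum_act [(gmod_act P u s).2 _](fun_actE (to := trivial_action _ _) _ _ tt).
  rewrite [(gmod_act P u s).2 _](fun_actE (to := trivial_action _ _) _ _ tt).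
  congr (_ + _).
  by rewrite (reindex_inj (@perm_inj _ s)); apply: eq_bigr => i _; apply: fun_actE.
- move=> y; congr pair; apply/ffunP => S; rewrite !ffunE; exact: quad_antisym.
- move=> x u xu0.
  have val0 (S : {S | S \in @small_subset n}) : quad (val S) x +
      ((#|val S|%:R - 1 - p%:R) * (\sum_(i in val S) u.1 i) +
      #|val S|%:R * u.2 tt) = 0.
    by have /ffunP/(_ S) := congr1 fst xu0; rewrite !ffunE.
  have diag i : entry i i x - p%:R * u.1 i + u.2 tt = 0.
    by rewrite -[RHS](val0 (small_subset1 i)) /= quad1 cards1 big_set1; ring.
  have offdiag i j : i != j ->
      entry i i x + entry j j x + polar i j x + (1 - p%:R) * (u.1 i + u.1 j) +
      2 * u.2 tt = 0.
    move=> ij; rewrite -[RHS](val0 (small_subset2 i j)) /= quad2 // cards2 ij.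
    by rewrite big_setU1 ?inE //= big_set1; ring.
  have total : \sum_i u.1 i + 2 * u.2 tt = 0.
    by have /ffunP/(_ tt) := congr1 snd xu0; rewrite !ffunE add0r.
  have rows i : \sum_j polar i j x = 0 by rewrite big_split /= sum_row sum_col.
  have [u0 k0 B0] := odd_kernel diag offdiag (fun i => erefl) total rows.
  split=> //; case: u u0 k0 {xu0 val0 diag offdiag total} => u k u0 k0.
  by congr pair; apply/ffunP => i; rewrite ffunE ?u0 //; case: i.
move=> [q r].
pose q1 i := q (small_subset1 i).
pose q2 i j := q (small_subset2 i j).
have q2C i j : q2 i j = q2 j i by rewrite /q2; congr (q _); apply/val_inj/setUC.
have [u [k [M [d [MC Md M0 [diag off total]]]]]] := odd_surj q1 (r tt) q2C.
have [x xM] := polar_surj MC Md M0.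
have xd i : entry i i x = d i by have := xM i i; rewrite Md /polar; lia.
exists x, ([ffun i => u i], [ffun _ => k]); congr pair; last first.
  apply/ffunP => -[]; rewrite !ffunE add0r total; congr (_ + _).
  by apply: eq_bigr => i _; rewrite ffunE.
apply/ffunP => S; rewrite !ffunE /=.
under eq_bigr do rewrite ffunE.
have [[i Si]|[i [j [ij Sij]]]] := small_subsetP (valP S).
  rewrite (_ : S = small_subset1 i) /=; last exact: val_inj.
  by rewrite quad1 cards1 big_set1 xd -/(q1 i) diag; ring.
rewrite (_ : S = small_subset2 i j) /=; last exact: val_inj.
rewrite quad2 // !xd xM cards2 ij big_setU1 ?inE // big_set1 -/(q2 i j) off //=; ring.
Qed.
End OddCase.

(** * The case n = 4 *)

Section Halvings.

(** A partition of {0, 1, 2, 3} into two pairs is encoded by its block containing 0. *)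
Definition halving : {pred {set 'I_4}} := fun S => (#|S| == 2) && (ord0 \in S).

Definition block0 (S : {set 'I_4}) : {set 'I_4} := if ord0 \in S then S else ~: S.

Lemma block0C S : block0 (~: S) = block0 S.
Proof. by rewrite /block0 in_setC; case: (ord0 \in S); rewrite //= setCK. Qed.

Lemma block0_halving (S : {set 'I_4}) : #|S| = 2 -> block0 S \in halving.
Proof.
move=> cS; rewrite unfold_in /block0; case: ifP => S0; first by rewrite cS S0.
by rewrite inE S0 andbT; have := cardsC S; rewrite cS card_ord; lia.
Qed.

Lemma imset_permC (s : 'S_4) (S : {set 'I_4}) : s @: (~: S) = ~: (s @: S).
Proof. by rewrite -!preim_permV preimsetC. Qed.

Lemma block0_imset (s : 'S_4) S : block0 (s @: block0 S) = block0 (s @: S).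
Proof. by rewrite {2}/block0; case: ifP => // _; rewrite imset_permC block0C. Qed.

Lemma halving_imset (S : {set 'I_4}) (s : 'S_4) :
  S \in halving -> block0 (s @: S) \in halving.
Proof.
rewrite {1}unfold_in => /andP[/eqP cS _]; apply: block0_halving.
by rewrite card_imset //; apply: perm_inj.
Qed.

Definition halving_act (S : {S | S \in halving}) (s : 'S_4) : {S | S \in halving} :=
  exist (fun S => S \in halving) _ (halving_imset s (valP S)).

Lemma halving_act_is_action : is_action [set: 'S_4] halving_act.
Proof.
apply: is_total_action => [S|S s t]; apply/val_inj => /=.
  rewrite (eq_imset _ (@perm1 _)) imset_id /block0.
  by case: S => S /=; rewrite unfold_in => /andP[_ ->].
rewrite block0_imset -imset_comp; congr block0.
by apply: eq_imset => j; rewrite permM.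
Qed.

Definition halving_action : {action 'S_4 &-> {S | S \in halving}} :=
  Action halving_act_is_action.

End Halvings.

Section Case4.
Import GRing.Theory Num.Theory.
Local Open Scope ring_scope.

(** For n = 4, the dual of A is spanned by four vectors f_i with sum zero, and its
    lattice of symmetric tensors by the four squares of f_i and the three squares of
    f_i + f_j = - (f_k + f_l). The only relation between them is that the two families
    have the same sum. As 4 - 3 = 1, that relation is split; dually, adding the
    diagonal copy of Z to Sym^2 A gives the whole permutation lattice of rank 4 + 3. *)
Lemma squares_equiv_A3 :
  lattice_equiv (exterior_square (latticeA 4))
                (tensor (latticeA 4) (latticeA 4)).
Proof.
pose T := tensor (latticeA 4) (latticeA 4).
pose X := fun_gmodule 'P : gmodule 'S_4.
pose Z := fun_gmodule (trivial_action 'S_4 unit).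
pose Y := fun_gmodule halving_action.
pose Q := prod_gmodule X Y.
pose phi0 (x : T) : Q := ([ffun i => quad [set i] x] : X, [ffun S => quad (val S) x] : Y).
pose psi0 (k : Z) : Q := ([ffun _ => k tt], [ffun _ => k tt]).
have phiB : zmod_morphism phi0.
  by move=> x y; congr pair; apply/ffunP => i; rewrite !ffunE quadB.
have psiB : zmod_morphism psi0.
  by move=> x y; congr pair; apply/ffunP => i; rewrite !ffunE.
have c_perm := permutation_basis_prod (fun_indicator_basis ('P : {action 'S_4 &-> 'I_4}))
  (fun_indicator_basis halving_action).
have quad_block0 S x : quad (block0 S) x = quad S x.
  by rewrite /block0; case: ifP => // _; apply: quadC.
pose a j : 'I_4 := inord j.
have big4 (F : 'I_4 -> int) : \sum_i F i = F (a 0%N) + F (a 1%N) + F (a 2) + F (a 3).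
  rewrite !big_ord_recl big_ord0 addr0 !addrA.
  by do !congr (_ + _); congr F; apply/val_inj; rewrite /= inordK.
have aP (i : 'I_4) : [\/ i = a 0%N, i = a 1%N, i = a 2 | i = a 3].
  case: i => [[|[|[|[|//]]]] i4];
    [constructor 1|constructor 2|constructor 3|constructor 4];
    by apply/val_inj; rewrite /= inordK.
have aE i j : (i < 4)%N -> (j < 4)%N -> (a i == a j) = (i == j).
  by move=> i4 j4; rewrite -val_eqE /= !inordK.
apply: (squares_equiv (fun_indicator_basis _) c_perm
  (phi := additive_of phiB) (psi := additive_of psiB)).
- move=> x s; congr pair; apply: fun_act_ext => i; rewrite !ffunE.
    by rewrite -(quad_act x s [set i]) imset_set1.
  by rewrite quad_block0 quad_act.
- by move=> k s; congr pair; apply: fun_act_ext => i; rewrite ![LHS]ffunE ![RHS]ffunE.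
- by move=> y; congr pair; apply/ffunP => S; rewrite !ffunE; exact: quad_antisym.
- move=> x k xk0.
  have diag i : entry i i x + k tt = 0.
    by have /ffunP/(_ i) := congr1 fst xk0; rewrite !ffunE quad1.
  have off i j : i != j -> entry i i x + entry j j x + polar i j x + k tt = 0.
    move=> ij; rewrite -quad2 // -quad_block0.
    have hS : block0 [set i; j] \in halving by apply: block0_halving; rewrite cards2 ij.
    have /ffunP/(_ (exist (fun S => S \in halving) _ hS)) := congr1 snd xk0.
    by rewrite !ffunE.
  have row : \sum_j polar (a 0%N) j x = 0 by rewrite big_split /= sum_row sum_col.
  (* Sum over the points: -4 k tt; sum over the partitions: -3 k tt. The two sums of
     values of the quadratic form agree. *)
  have k0 : k tt = 0.
    have := (diag (a 0%N), diag (a 1%N), diag (a 2), diag (a 3)).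
    have := (off (a 0%N) (a 1%N), off (a 0%N) (a 2), off (a 0%N) (a 3)).
    rewrite !aE // => -[[/(_ isT) o1 /(_ isT) o2] /(_ isT) o3] [[[d0 d1] d2] d3].
    move: row; rewrite big4 [polar (a 0%N) (a 0%N) x]/polar.
    by move: (k tt) (entry _ _ _) (entry _ _ _) (entry _ _ _) (entry _ _ _) (polar _ _ _)
      (polar _ _ _) (polar _ _ _) o1 o2 o3 d0 d1 d2 d3; lia.
  have d0 i : entry i i x = 0 by rewrite -(diag i) k0 addr0.
  split=> [|i j]; first by apply/ffunP => -[]; rewrite k0 ffunE.
  have [<-|ij] := eqVneq i j; first by rewrite /polar d0.
  by have := off i j ij; rewrite !d0 k0 addr0 !add0r.
move=> [q r].
pose y S : int := oapp r 0 (insub S).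
pose pair_val i j := y (block0 [set i; j]).
have pair_valC i j : pair_val i j = pair_val j i by rewrite /pair_val setUC.
have pair_val_opp i j k l :
    i != j -> i != k -> i != l -> j != k -> j != l -> k != l ->
    pair_val i j = pair_val k l.
  move=> ij ik il jk jl kl; rewrite /pair_val -block0C; congr (y (block0 _)).
  have cC := cardsC [set i; j]; rewrite cards2 ij card_ord in cC.
  apply/esym/eqP; rewrite eqEcard subUset !sub1set !in_setC !in_set2.
  by rewrite !negb_or ![_ == i]eq_sym ![_ == j]eq_sym ik jk il jl cards2 kl; lia.
pose k := \sum_i q i -
  (pair_val (a 0%N) (a 1%N) + pair_val (a 0%N) (a 2) + pair_val (a 0%N) (a 3)).
pose d i := q i - k.
pose M i j := if i == j then d i *+ 2 else pair_val i j - k - d i - d j.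
have [||i|x xM] := @polar_surj 3 M d.
- by move=> i j; rewrite /M eq_sym pair_valC; case: eqP => [->|_] //; ring.
- by move=> i; rewrite /M eqxx.
(* Complementary pairs give the same value, so every row sum only involves the
   three values at the pairs containing 0. *)
- have Y23 : pair_val (a 2) (a 3) = pair_val (a 0%N) (a 1%N).
    by apply: pair_val_opp; rewrite aE.
  have Y13 : pair_val (a 1%N) (a 3) = pair_val (a 0%N) (a 2).
    by apply: pair_val_opp; rewrite aE.
  have Y12 : pair_val (a 1%N) (a 2) = pair_val (a 0%N) (a 3).
    by apply: pair_val_opp; rewrite aE.
  rewrite big4 /M; case: (aP i) => ->; rewrite !aE //=;
    rewrite ?(pair_valC (a 1%N) (a 0%N)) ?(pair_valC (a 2) (a 0%N));
    rewrite ?(pair_valC (a 3) (a 0%N)) ?(pair_valC (a 2) (a 1%N));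
    rewrite ?(pair_valC (a 3) (a 1%N)) ?(pair_valC (a 3) (a 2)) ?Y23 ?Y13 ?Y12;
    by rewrite /d /k big4; ring.
have xd i : entry i i x = d i by have := xM i i; rewrite /M eqxx /polar; lia.
exists x, [ffun _ => k]; congr pair; apply/ffunP => i; rewrite !ffunE.
  by rewrite quad1 xd /d subrK.
have /andP[/cards2P [j [l [jl Sjl]]] S0] : val i \in halving by apply: valP.
rewrite Sjl quad2 // !xd xM /M (negPf jl) /pair_val -Sjl /block0 S0 /y valK /=; ring.
Qed.
End Case4.

Theorem mainTheorem2 (n : nat) (n_ge2 : 2 <= n)
    (n_odd_or_2_or_4 : [\/ odd n, n = 2 | n = 4]) :
  lattice_equiv (exterior_square (latticeA n))
                (tensor (latticeA n) (latticeA n)).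
Proof.
case: n_odd_or_2_or_4 => [n_odd|->|->].
- have -> : n = (n./2.*2).+1 by rewrite -[LHS]odd_double_half n_odd.
  exact: squares_equiv_odd.
- exact: squares_equiv_A1.
exact: squares_equiv_A3.
Qed.
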